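(* Let $1\le l<k$ and let nonnegative shifts $\{\lambda_i\}_{i=1}^{k-l}$, $\{\mu_i\}_{i=1}^{k-l}$ satisfy $\lambda_i^2+\mu_i^2=1$. Let $G,P,\bar G$ be the orthogonal matrices accumulated in the $k-l$ implicit QR steps (implicit restarts of the joint Lanczos lower and upper bidiagonalizations) with these shifts described in the context. Let $V_l^+,U_{l+1}^+,\widehat U_l^+$ consist of the first $l$, $l+1$, $l$ columns of $V_kP$, $U_{k+1}G$, $\widehat U_k\bar G$, respectively, and let $B_l^+$ and $\bar B_l^+$ be the leading $(l+1)\times l$ and $l\times l$ submatrices of $G^{\mathrm T}B_kP$ and $\bar G^{\mathrm T}\bar B_kP$. Let $H_l^+=R^{-1}V_l^+$. Then the $(k-l)$-step implicit restart generates an implicitly restarted $l$-step JBD process: $$AH_l^+=U_{l+1}^+B_l^+,\qquad LH_l^+=\widehat U_l^+\bar B_l^+,$$ $$B_l^{+\mathrm T}B_l^++\bar B_l^{+\mathrm T}\bar B_l^+=I_l.$$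
   Context: $e_i$ is the $i$-th column of an identity matrix of appropriate size; exact arithmetic; $\|\cdot\|$ is the 2-norm. **Joint Lanczos bidiagonalizations / JBD process.** $A\in\mathbb{R}^{m\times n}$, $L\in\mathbb{R}^{p\times n}$, $m+p\ge n$, $\operatorname{rank}((A^{\mathrm T},L^{\mathrm T})^{\mathrm T})=n$, with economy QR factorization $\begin{pmatrix}A\\L\end{pmatrix}=\begin{pmatrix}Q_A\\Q_L\end{pmatrix}R$. With unit starting vectors $u_1$ and $\hat v_1=v_1=Q_A^{\mathrm T}u_1/\|Q_A^{\mathrm T}u_1\|$ (no breakdown), $$Q_AV_k=U_{k+1}B_k,\quad Q_A^{\mathrm T}U_{k+1}=V_kB_k^{\mathrm T}+\alpha_{k+1}v_{k+1}e_{k+1}^{\mathrm T},$$ $$Q_L\widehat V_k=\widehat U_k\widehat B_k,\quad Q_L^{\mathrm T}\widehat U_k=\widehat V_k\widehat B_k^{\mathrm T}+\hat\beta_k\hat v_{k+1}e_k^{\mathrm T},$$ where $U_{k+1}=(u_1,\dots,u_{k+1})$, $(V_k,v_{k+1})=(v_1,\dots,v_{k+1})$, $\widehat U_k$, $\widehat V_k=(\hat v_1,\dots,\hat v_k)$ have orthonormal columns, $B_k\in\mathbb{R}^{(k+1)\times k}$ is lower bidiagonal with diagonal $\alpha_1,\dots,\alpha_k$ and subdiagonal $\beta_2,\dots,\beta_{k+1}$, $\widehat B_k\in\mathbb{R}^{k\times k}$ is upper bidiagonal with diagonal $\hat\alpha_1,\dots,\hat\alpha_k$ and superdiagonal $\hat\beta_1,\dots,\hat\beta_{k-1}$,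 and all $\alpha_i,\beta_i,\hat\alpha_i$ are positive. Known facts: $\hat v_{i+1}=(-1)^iv_{i+1}$, $\hat\alpha_i\hat\beta_i=\alpha_{i+1}\beta_{i+1}$ ($i=1,\dots,k$). With $D_k=\operatorname{diag}(1,-1,\dots,(-1)^{k-1})$, $\bar B_k=\widehat B_kD_k$, $\bar\beta_k=(-1)^k\hat\beta_k$, $H_k=R^{-1}V_k$, one has $Q_LV_k=\widehat U_k\bar B_k$, $Q_L^{\mathrm T}\widehat U_k=V_k\bar B_k^{\mathrm T}+\bar\beta_kv_{k+1}e_k^{\mathrm T}$, and the $k$-step JBD process of $\{A,L\}$ reads $AH_k=U_{k+1}B_k$, $LH_k=\widehat U_k\bar B_k$, $B_k^{\mathrm T}B_k+\bar B_k^{\mathrm T}\bar B_k=I_k$. **One implicit QR step with shifts $(\lambda,\mu)$, $\lambda^2+\mu^2=1$**, on a pair $(B,\bar B)$ with $B\in\mathbb{R}^{(k+1)\times k}$ lower bidiagonal, $\bar B\in\mathbb{R}^{k\times k}$ upper bidiagonal, $B^{\mathrm T}B+\bar B^{\mathrm T}\bar B=I_k$. (i) Choose a Givens rotation $G_1$ in the plane $(1,2)$ such that the $(2,1)$-entry of $G_1^{\mathrm T}(BB^{\mathrm T}-\lambda^2I_{k+1})$ is zero; starting from $G_1^{\mathrm T}B$, for $j=1,\dots,k-1$ in turn choose a Givens rotation $P_j$ in the plane $(j,j+1)$, applied on the right, annihilating the $(j,j+1)$-entry, then a Givens rotation $G_{j+1}$ in the plane $(j+1,j+2)$, with $G_{j+1}^{\mathrm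 T}$ applied on the left, annihilating the $(j+2,j)$-entry. (A rotation is taken to be the identity if the pair of entries it acts on to annihilate is $(0,0)$.) (ii) On $\bar B$, perform the analogous bulge chasing for the shift $\mu^2$ on $\bar B^{\mathrm T}\bar B$; since $\bar B^{\mathrm T}\bar B-\mu^2I=-(B^{\mathrm T}B-\lambda^2I)$, its right rotations are the same $P_j$: for $j=1,\dots,k-1$ in turn apply $P_j$ on the right and then $\bar G_j^{\mathrm T}$ on the left, where $\bar G_j$ is a Givens rotation in the plane $(j,j+1)$ annihilating the $(j+1,j)$-entry. The step produces $G_1\cdots G_k$, $P_1\cdots P_{k-1}$, $\bar G_1\cdots\bar G_{k-1}$. **Multi-step.** Perform $k-l$ such steps in turn, starting from $(B_k,\bar B_k)$, the $i$-th with shifts $(\lambda_i,\mu_i)$, yielding $G^{(i)},P^{(i)},\bar G^{(i)}$ and replacing the current pair $(B,\bar B)$ by $(G^{(i)\mathrm T}BP^{(i)},\bar G^{(i)\mathrm T}\bar BP^{(i)})$. Set $G=G^{(1)}\cdots G^{(k-l)}$, $P=P^{(1)}\cdots P^{(k-l)}$, $\bar G=\bar G^{(1)}\cdots\bar G^{(k-l)}$. *)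

(* Defs.v *)
(* Indices of scalars, rotations, planes and matrix
   entries are 1-based, so that the formulas read as in the literature; an
   ordinal [a : 'I_n] stands for the row or column number [a.+1]. *)
From HB Require Import structures.
From mathcomp Require Import all_boot all_order all_algebra.

Set Implicit Arguments.
Unset Strict Implicit.
Unset Printing Implicit Defensive.
Import Order.TTheory GRing.Theory Num.Theory.
Local Open Scope ring_scope.

Definition norm2 (F : rcfType) n (x : 'cV[F]_n) : F :=
  Num.sqrt (\sum_(i < n) x i 0 ^+ 2).

Definition orthonormal_cols (F : rcfType) m n (M : 'M[F]_(m, n)) : Prop :=
  M^T *m M = 1%:M.

Definition e_ (F : rcfType) n (i : nat) : 'cV[F]_n :=
  \col_(a < n) (a.+1 == i)%:R.

Definition lead_cols (F : rcfType) n k l (h : (l <= k)%N)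
    (M : 'M[F]_(n, k)) : 'M[F]_(n, l) :=
  colsub (widen_ord h) M.

Definition lead_submx (F : rcfType) m n r s (hr : (r <= m)%N) (hs : (s <= n)%N)
    (M : 'M[F]_(m, n)) : 'M[F]_(r, s) :=
  mxsub (widen_ord hr) (widen_ord hs) M.

Definition lower_bidiagonal (F : rcfType) m n (M : 'M[F]_(m, n)) : Prop :=
  forall (a : 'I_m) (b : 'I_n), a != b :> nat -> a != b.+1 :> nat -> M a b = 0.

Definition upper_bidiagonal (F : rcfType) m n (M : 'M[F]_(m, n)) : Prop :=
  forall (a : 'I_m) (b : 'I_n), b != a :> nat -> b != a.+1 :> nat -> M a b = 0.

Definition lower_bidiag_mx (F : rcfType) k (alpha beta : nat -> F) :
    'M[F]_(k.+1, k) :=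
  \matrix_(a < k.+1, b < k)
    if (a : nat) == b then alpha b.+1
    else if (a : nat) == b.+1 then beta b.+2 else 0.

Definition upper_bidiag_mx (F : rcfType) k (alpha beta : nat -> F) : 'M[F]_k :=
  \matrix_(a < k, b < k)
    if (b : nat) == a then alpha a.+1
    else if (b : nat) == a.+1 then beta a.+1 else 0.

(* diag(1, -1, 1, ..., (-1)^(k-1)) *)
Definition altsign_mx (F : rcfType) k : 'M[F]_k :=
  diag_mx (\row_(j < k) (-1) ^+ j).

Record economy_QR (F : rcfType) m p n (A : 'M[F]_(m, n)) (L : 'M[F]_(p, n))
    (QA : 'M[F]_(m, n)) (QL : 'M[F]_(p, n)) (R : 'M[F]_n) : Prop := EconomyQR {
  eqr_eq : col_mx A L = col_mx QA QL *m R;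
  eqr_orth : orthonormal_cols (col_mx QA QL);
  eqr_upper : forall a b : 'I_n, (b < a)%N -> R a b = 0
}.

(* k steps, without breakdown, of the two Lanczos bidiagonalizations, of QA
   started from u_1 and of QL started from v_1.  Requiring the [betah i] to be
   positive fixes the signs of the vectors \hat v_(i+1); the relations
   \hat v_(i+1) = (-1)^i v_(i+1) and
   alphah i * betah i = alpha (i+1) * beta (i+1) are then consequences. *)
Record joint_lanczos (F : rcfType) m p n k
    (QA : 'M[F]_(m, n)) (QL : 'M[F]_(p, n))
    (U : 'M[F]_(m, k.+1)) (V : 'M[F]_(n, k)) (vnext : 'cV[F]_n)
    (Uh : 'M[F]_(p, k)) (Vh : 'M[F]_(n, k)) (vhnext : 'cV[F]_n)
    (alpha beta alphah betah : nat -> F) : Prop := JointLanczos {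
  jl_U : orthonormal_cols U;
  jl_V : orthonormal_cols (row_mx V vnext);
  jl_Uh : orthonormal_cols Uh;
  jl_Vh : orthonormal_cols (row_mx Vh vhnext);
  jl_alpha : forall i, (1 <= i <= k.+1)%N -> 0 < alpha i;
  jl_beta : forall i, (2 <= i <= k.+1)%N -> 0 < beta i;
  jl_alphah : forall i, (1 <= i <= k)%N -> 0 < alphah i;
  jl_betah : forall i, (1 <= i <= k)%N -> 0 < betah i;
  jl_start : forall j : 'I_k, j.+1 = 1%N ->
    col j V = (norm2 (QA^T *m col ord0 U))^-1 *: (QA^T *m col ord0 U);
  jl_starth : forall j : 'I_k, j.+1 = 1%N -> col j Vh = col j V;
  jl_QA : QA *m V = U *m lower_bidiag_mx k alpha beta;
  jl_QAT : QA^T *m U = V *m (lower_bidiag_mx k alpha beta)^T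
             + alpha k.+1 *: (vnext *m (e_ F k.+1 k.+1)^T);
  jl_QL : QL *m Vh = Uh *m upper_bidiag_mx k alphah betah;
  jl_QLT : QL^T *m Uh = Vh *m (upper_bidiag_mx k alphah betah)^T
             + betah k *: (vhnext *m (e_ F k k)^T)
}.

(* rotation with cosine c and sine s in the plane (i, i+1) *)
Definition givens (F : rcfType) n (i : nat) (c s : F) : 'M[F]_n :=
  \matrix_(a < n, b < n)
    if (a.+1 == i) && (b.+1 == i) then c
    else if (a.+1 == i) && (b.+1 == i.+1) then s
    else if (a.+1 == i.+1) && (b.+1 == i) then - s
    else if (a.+1 == i.+1) && (b.+1 == i.+1) then c
    else (a == b)%:R.

Definition is_givens (F : rcfType) n (i : nat) (G : 'M[F]_n) : Prop :=
  exists c s : F, c ^+ 2 + s ^+ 2 = 1 /\ G = givens n i c s.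

Definition zero_entry (F : rcfType) m n (M : 'M[F]_(m, n)) (i j : nat) : Prop :=
  forall (a : 'I_m) (b : 'I_n), a.+1 = i -> b.+1 = j -> M a b = 0.

(* G^T, applied on the left of M, annihilates the (i+1, j)-entry against the
   (i, j)-entry *)
Definition left_givens (F : rcfType) m n (G : 'M[F]_m) (M : 'M[F]_(m, n))
    (i j : nat) : Prop :=
  [/\ is_givens i G,
      zero_entry (G^T *m M) i.+1 j
    & zero_entry M i j -> zero_entry M i.+1 j -> G = 1%:M].

(* P, applied on the right of M, annihilates the (i, j+1)-entry against the
   (i, j)-entry *)
Definition right_givens (F : rcfType) m n (P : 'M[F]_n) (M : 'M[F]_(m, n))
    (i j : nat) : Prop :=
  [/\ is_givens j P,
      zero_entry (M *m P) i j.+1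
    & zero_entry M i j -> zero_entry M i j.+1 -> P = 1%:M].

(* One implicit QR step on (B, Bb) with shifts (lambda, mu).  The shift mu does
   not occur: by B^T B + Bb^T Bb = 1 and lambda^2 + mu^2 = 1, the chasing on Bb
   uses the right rotations of the chasing on B.  The Givens rotations are
   determined up to sign only, hence a relation rather than a function. *)
Definition implicit_QR_step (F : rcfType) k (lambda : F)
    (B : 'M[F]_(k.+1, k)) (Bb : 'M[F]_k)
    (G : 'M[F]_k.+1) (P Gb : 'M[F]_k) : Prop :=
  exists (Gs : nat -> 'M[F]_k.+1) (Ps Gbs : nat -> 'M[F]_k),
    let B_ j :=
      (\prod_(1 <= i < j.+1) Gs i)^T *m B *m \prod_(1 <= i < j) Ps i in
    let Bb_ j :=
      (\prod_(1 <= i < j) Gbs i)^T *m Bb *m \prod_(1 <= i < j) Ps i in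
    [/\ left_givens (Gs 1%N) (B *m B^T - (lambda ^+ 2)%:M) 1 1,
        forall j, (1 <= j < k)%N ->
          [/\ right_givens (Ps j) (B_ j) j j,
              left_givens (Gs j.+1) (B_ j *m Ps j) j.+1 j
            & left_givens (Gbs j) (Bb_ j *m Ps j) j j],
        G = \prod_(1 <= i < k.+1) Gs i,
        P = \prod_(1 <= i < k) Ps i
      & Gb = \prod_(1 <= i < k) Gbs i].

Definition implicit_QR_steps (F : rcfType) k (s : nat) (lambda : nat -> F)
    (B : 'M[F]_(k.+1, k)) (Bb : 'M[F]_k)
    (G : 'M[F]_k.+1) (P Gb : 'M[F]_k) : Prop :=
  exists (Gi : nat -> 'M[F]_k.+1) (Pi Gbi : nat -> 'M[F]_k),
    [/\ forall i, (1 <= i <= s)%N ->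
          implicit_QR_step (lambda i)
            ((\prod_(1 <= j < i) Gi j)^T *m B *m \prod_(1 <= j < i) Pi j)
            ((\prod_(1 <= j < i) Gbi j)^T *m Bb *m \prod_(1 <= j < i) Pi j)
            (Gi i) (Pi i) (Gbi i),
        G = \prod_(1 <= j < s.+1) Gi j,
        P = \prod_(1 <= j < s.+1) Pi j
      & Gb = \prod_(1 <= j < s.+1) Gbi j].

(* the shape of the factors of an l-step joint bidiagonalization; no sign is
   prescribed for the entries of B and Bb *)
Record JBD_factors (F : rcfType) m p n l (V : 'M[F]_(n, l))
    (U : 'M[F]_(m, l.+1)) (Uh : 'M[F]_(p, l))
    (B : 'M[F]_(l.+1, l)) (Bb : 'M[F]_l) : Prop := JBDFactors {
  jbd_V : orthonormal_cols V;
  jbd_U : orthonormal_cols U;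
  jbd_Uh : orthonormal_cols Uh;
  jbd_B : lower_bidiagonal B;
  jbd_Bb : upper_bidiagonal Bb
}.

(* Main.v *)
(* Bulge chasing keeps B lower bidiagonal and Bb upper triangular, by following
   the support of the matrices through the rotations.  As B^T B + Bb^T Bb = 1 is
   preserved, the final Bb^T Bb is tridiagonal; Bb being upper triangular and
   invertible, it is then upper bidiagonal.  Hence the first l columns of the
   two factors vanish below rows l+1 and l, so that truncating the updated
   relations QA (V P) = (U G) B and QL (V P) = (Uh Gb) Bb loses nothing.
   The relation for QL V rests on \hat v_(i+1) = (-1)^i v_(i+1), which is the
   uniqueness of the Lanczos process: QA^T QA and QL^T QL = 1 - QA^T QA are both
   reduced to Hessenberg form from the same starting vector. *)
Require Import Defs.
From HB Require Import structures.
From mathcomp Require Import all_boot all_order all_algebra.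
From mathcomp Require Import zify ring.

Set Implicit Arguments.
Unset Strict Implicit.
Unset Printing Implicit Defensive.
Import Order.TTheory GRing.Theory Num.Theory.
Local Open Scope ring_scope.

(** * Support and orthogonality of plane rotations *)

Section Givens.
Variable F : rcfType.

Lemma givens_neq0 n i (c s : F) (a b : 'I_n) :
  givens n i c s a b != 0 ->
  (a : nat) = b \/ (i <= a.+1 <= i.+1)%N /\ (i <= b.+1 <= i.+1)%N.
Proof.
rewrite mxE; do 4 ![case: ifP => [/andP[/eqP ? /eqP ?] _|_]; first by lia].
by have [->|_] := eqVneq a b; [left|rewrite eqxx].
Qed.

(** The bound on [i] puts both rows of the plane inside the matrix. The sum over rows splits into
    these two rows, where c^2 + s^2 = 1 enters, and the rest, where the rotation is the identity. *)
Lemma givens_orth n i (c s : F) : (0 < i < n)%N -> c ^+ 2 + s ^+ 2 = 1 ->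
  (givens n i c s)^T *m givens n i c s = 1%:M.
Proof.
case: i => // i /= lt_in cs1.
pose u := Ordinal (ltnW lt_in); pose v := Ordinal lt_in.
have uv : u != v by rewrite -val_eqE /=; lia.
apply/matrixP => a b; rewrite !mxE (bigD1 u) //= (bigD1 v) /=; last by rewrite eq_sym.
rewrite (eq_bigr (fun j => (j == a)%:R * (j == b)%:R)); last first.
  move=> j /andP[]; rewrite -!val_eqE /= => /negbTE ju /negbTE jv.
  by rewrite !mxE !eqSS ju jv.
have au : (a == i :> nat) = (a == u) by rewrite -val_eqE.
have av : (a == i.+1 :> nat) = (a == v) by rewrite -val_eqE.
have bu : (b == i :> nat) = (b == u) by rewrite -val_eqE.
have bv : (b == i.+1 :> nat) = (b == v) by rewrite -val_eqE.
have ii : (i == i.+1) = false by lia.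
have ii' : (i.+1 == i) = false by lia.
have S0 (x y : 'I_n) : (x == u) || (x == v) || (y == u) || (y == v) || (x != y) ->
  \sum_(j | (j != u) && (j != v)) (j == x)%:R * (j == y)%:R = 0 :> F.
  move=> H; apply: big1 => j /andP[ju jv].
  case: eqP => [jx|]; last by rewrite mul0r.
  case: eqP => [jy|]; last by rewrite mulr0.
  by move: H ju jv; rewrite -jx -jy eqxx; do 2 case: eqP.
rewrite !mxE !eqSS !eqxx ii ii' au av bu bv /=.
have [->|au'] := eqVneq a u.
  rewrite S0 ?eqxx //=.
  have [_|_] := eqVneq b u; first by rewrite mulr1n -cs1; ring.
  by rewrite mulr0n; have [_|_] := eqVneq b v; rewrite ?mulr0n; ring.
have [->|av'] := eqVneq a v.
  rewrite S0 ?eqxx ?orbT //=.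
  have [->|_] := eqVneq b u; first by rewrite (eq_sym v) (negbTE uv) mulr0n; ring.
  by have [_|_] := eqVneq b v; rewrite ?mulr1n ?mulr0n -?cs1; ring.
rewrite !mul0r !add0r; have [<-|ab] := eqVneq a b; last by rewrite S0 ?ab ?orbT.
rewrite (bigD1 a) ?au' // eqxx mulr1 big1 => [|j]; first exact: addr0.
by case/andP=> _ /negbTE->; rewrite mul0r.
Qed.

Lemma is_givens_orth n i (G : 'M[F]_n) :
  (0 < i < n)%N -> is_givens i G -> G^T *m G = 1%:M.
Proof. by move=> hi [c [s [cs1 ->]]]; exact: givens_orth. Qed.

(** Column [b] of [M *m P] is that of [M] unless [b] lies in the plane, where it mixes the two plane
    columns; the last premise covers that case. *)
Lemma mul_givens_eq0 m n i (P : 'M[F]_n) (M : 'M[F]_(m, n)) a b :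
  is_givens i P -> M a b = 0 ->
  (forall c : 'I_n, (i <= b.+1 <= i.+1)%N -> (i <= c.+1 <= i.+1)%N -> M a c = 0) ->
  (M *m P) a b = 0.
Proof.
move=> [c [s [_ ->]]] Mab0 M0; rewrite mxE big1 // => d _.
have [->|/givens_neq0[/ord_inj->|[di bi]]] := eqVneq (givens n i c s d b) 0.
- by rewrite mulr0.
- by rewrite Mab0 mul0r.
- by rewrite M0 // mul0r.
Qed.

Lemma trgivens_mul_eq0 m n i (G : 'M[F]_m) (M : 'M[F]_(m, n)) a b :
  is_givens i G -> M a b = 0 ->
  (forall c : 'I_m, (i <= a.+1 <= i.+1)%N -> (i <= c.+1 <= i.+1)%N -> M c b = 0) ->
  (G^T *m M) a b = 0.
Proof.
move=> hG Mab0 M0; rewrite -[_ *m M]trmxK trmx_mul trmxK mxE.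
by apply: mul_givens_eq0 hG _ _ => [|d ai di]; rewrite mxE //; exact: M0.
Qed.

Lemma prodmx_orth n (X : nat -> 'M[F]_n) r s :
  (forall i, (r <= i < s)%N -> (X i)^T *m X i = 1%:M) ->
  (\prod_(r <= i < s) X i)^T *m (\prod_(r <= i < s) X i) = 1%:M.
Proof.
elim: s => [|s IH] hX; first by rewrite big_geq // trmx1 mul1mx.
have [rs|sr] := leqP r s; last by rewrite big_geq // trmx1 mul1mx.
rewrite big_nat_recr //= -mulmxE trmx_mul mulmxA -(mulmxA (X s)^T) IH ?mulmx1.
  by rewrite hX ?rs ?leqnn.
by move=> i /andP[ri si]; rewrite hX // ri ltnW.
Qed.

End Givens.

(** * Bulge chasing within one step *)

Section Chase.
Variable F : rcfType.

(** [is_trig_mx] means lower triangular, so upper triangularity is put on the transpose, where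
    [det_trig] applies. *)
Lemma trig_trmxP n {M : 'M[F]_n} :
  reflect (forall a b : 'I_n, (b < a)%N -> M a b = 0) (is_trig_mx M^T).
Proof.
apply: (iffP is_trig_mxP) => H a b ab; last by rewrite mxE H.
by have := H b a ab; rewrite mxE.
Qed.

Variables (k : nat) (lambda : F) (B : 'M[F]_(k.+1, k)) (Bb : 'M[F]_k).
Variables (G : 'M[F]_k.+1) (P Gb : 'M[F]_k).
Hypothesis k_gt1 : (1 < k)%N.

Lemma implicit_QR_step_orth : implicit_QR_step lambda B Bb G P Gb ->
  [/\ G^T *m G = 1%:M, P^T *m P = 1%:M & Gb^T *m Gb = 1%:M].
Proof.
move=> [Gs [Ps [Gbs [[hG1 _ _] hj -> -> ->]]]]; split; apply: prodmx_orth.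
- case=> [|[|j]] // hi; first by apply: is_givens_orth hG1; lia.
  by have [|_ [hG _ _] _] := hj j.+1; [lia|apply: is_givens_orth hG; lia].
- by move=> j hi; have [|[hP _ _] _ _] := hj j; [lia|apply: is_givens_orth hP; lia].
- by move=> j hi; have [|_ _ [hP _ _]] := hj j; [lia|apply: is_givens_orth hP; lia].
Qed.

(** [Ps j] trades the bulge at (j, j+1) for one at (j+2, j), and [Gs j.+1] trades that one for (j+1,
    j+2). *)
Lemma implicit_QR_step_lower : lower_bidiagonal B ->
  implicit_QR_step lambda B Bb G P Gb -> lower_bidiagonal (G^T *m B *m P).
Proof.
move=> hB [Gs [Ps [Gbs [[hG1 _ _] + -> -> _]]]].
set B_ := fun j => (\prod_(1 <= i < j.+1) Gs i)^T *m B *m \prod_(1 <= i < j) Ps i.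
rewrite -[_ *m _ *m _]/(B_ k) => hj.
(* B_ j is lower bidiagonal except for a bulge in position (j, j+1) *)
have bulge j : (0 < j <= k)%N -> forall (a : 'I_k.+1) (b : 'I_k),
    a != b :> nat -> a != b.+1 :> nat -> ~~ ((a.+1 == j) && (b == j :> nat)) ->
    B_ j a b = 0.
  elim: j => [|[|j] IH] // hjk a b ab ab1 nbul.
    rewrite /B_ big_nat1 big_geq // mulmx1.
    apply: trgivens_mul_eq0 hG1 _ _ => [|c ha hc]; apply: hB; lia.
  have -> : B_ j.+2 = (Gs j.+2)^T *m (B_ j.+1 *m Ps j.+1).
    rewrite /B_ (big_nat_recr j.+2 1 Gs) //= (big_nat_recr j.+1 1 Ps) //=.
    by rewrite -!mulmxE trmx_mul !mulmxA.
  have [|[hP zP _] [hG zG _] _] := hj j.+1; first by lia.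
  have {}IH := IH ltac:(lia).
  (* Between the two rotations the only possible nonzero off the band is, in 1-based terms, at (j+3,
     j+1); [zG] removes it. *)
  have H1 (c : 'I_k.+1) (d : 'I_k) : c != d :> nat -> c != d.+1 :> nat ->
      ~~ ((c == j.+2 :> nat) && (d == j :> nat)) -> (B_ j.+1 *m Ps j.+1) c d = 0.
    move=> cd cd1 ncd.
    have [/andP[/eqP cj /eqP dj]|nb] := boolP ((c == j :> nat) && (d == j.+1 :> nat)).
      by apply: zP; lia.
    by apply: mul_givens_eq0 hP _ _ => [|e hd he]; apply: IH; lia.
  have [/andP[/eqP aj /eqP bj]|nb] := boolP ((a == j.+2 :> nat) && (b == j :> nat)).
    by apply: zG; lia.
  by apply: trgivens_mul_eq0 hG _ _ => [|e hd he]; apply: H1; lia.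
(* At j = k the bulge would lie in column k+1, which does not exist. *)
by move=> a b ab ab1; apply: bulge => //; have := ltn_ord b; lia.
Qed.

(** [Ps j] fills (j+1, j) and [Gbs j] clears it. Fill-in above the superdiagonal is not tracked
    here; a Gram matrix argument excludes it later. *)
Lemma implicit_QR_step_upper : is_trig_mx Bb^T ->
  implicit_QR_step lambda B Bb G P Gb -> is_trig_mx (Gb^T *m Bb *m P)^T.
Proof.
move=> hB [Gs [Ps [Gbs [_ + _ -> ->]]]].
set B_ := fun j => (\prod_(1 <= i < j) Gbs i)^T *m Bb *m \prod_(1 <= i < j) Ps i.
rewrite -[_ *m _ *m _]/(B_ k) => hj.
suff: forall j, (0 < j <= k)%N -> forall a b : 'I_k, (b < a)%N -> B_ j a b = 0.
  by move=> up; apply/trig_trmxP; apply: up; lia.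
elim=> [|[|j] IH] // hjk a b ba.
  by rewrite /B_ !big_geq // trmx1 mul1mx mulmx1 (trig_trmxP hB).
have -> : B_ j.+2 = (Gbs j.+1)^T *m (B_ j.+1 *m Ps j.+1).
  rewrite /B_ (big_nat_recr j.+1 1 Gbs) //= (big_nat_recr j.+1 1 Ps) //=.
  by rewrite -!mulmxE trmx_mul !mulmxA.
have [|[hP _ _] _ [hG zG _]] := hj j.+1; first by lia.
have {}IH := IH ltac:(lia).
have H1 (c d : 'I_k) : (d < c)%N ->
    ~~ ((c == j.+1 :> nat) && (d == j :> nat)) -> (B_ j.+1 *m Ps j.+1) c d = 0.
  move=> cd ncd.
  by apply: mul_givens_eq0 hP _ _ => [|e hd he]; apply: IH; lia.
have [/andP[/eqP aj /eqP bj]|nb] := boolP ((a == j.+1 :> nat) && (b == j :> nat)).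
  by apply: zG; lia.
by apply: trgivens_mul_eq0 hG _ _ => [|e hd he]; apply: H1; lia.
Qed.

End Chase.

(** * Several steps in succession *)

Section Steps.
Variable F : rcfType.

(** For the second factor only triangularity is passed from step to step; bidiagonality is recovered
    once, at the end. *)
Lemma implicit_QR_steps_shape k s (lambda : nat -> F) (B : 'M[F]_(k.+1, k))
    (Bb : 'M[F]_k) (G : 'M[F]_k.+1) (P Gb : 'M[F]_k) :
  (1 < k)%N -> lower_bidiagonal B -> is_trig_mx Bb^T ->
  implicit_QR_steps s lambda B Bb G P Gb ->
  [/\ G^T *m G = 1%:M, P^T *m P = 1%:M, Gb^T *m Gb = 1%:M,
      lower_bidiagonal (G^T *m B *m P) & is_trig_mx (Gb^T *m Bb *m P)^T].
Proof.
move=> k_gt1 hB hBb [Gi [Pi [Gbi [hstep -> -> ->]]]].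
split; try by apply: prodmx_orth => i hi;
  have [|? ? ?] := implicit_QR_step_orth k_gt1 (hstep i _) => //; lia.
- elim: s hstep => [|s IH] hstep; first by rewrite !big_geq // trmx1 mul1mx mulmx1.
  rewrite !(big_nat_recr s.+1) //= -!mulmxE trmx_mul !mulmxA.
  rewrite -(mulmxA (Gi _)^T) -(mulmxA (Gi _)^T).
  apply: implicit_QR_step_lower (hstep s.+1 _) => //; last by lia.
  by apply: IH => i hi; apply: hstep; lia.
- elim: s hstep => [|s IH] hstep; first by rewrite !big_geq // trmx1 mul1mx mulmx1.
  set M := _ *m Bb *m _.
  have -> : M = (Gbi s.+1)^T *m ((\prod_(1 <= j < s.+1) Gbi j)^T *m Bb *m
      \prod_(1 <= j < s.+1) Pi j) *m Pi s.+1.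
    by rewrite /M !(big_nat_recr s.+1) //= -!mulmxE trmx_mul !mulmxA.
  apply: implicit_QR_step_upper (hstep s.+1 _) => //; last by lia.
  by apply: IH => i hi; apply: hstep; lia.
Qed.

End Steps.

(** * Gram matrices of bidiagonal factors and uniqueness of Lanczos vectors *)

Section Lanczos.
Variable F : rcfType.

Lemma mul_mx_altsign k (m : nat) (M : 'M[F]_(m, k)) a b :
  (M *m altsign_mx F k) a b = M a b * (-1) ^+ b.
Proof. by rewrite mul_mx_diag !mxE. Qed.

Lemma altsign_mxK k : altsign_mx F k *m altsign_mx F k = 1%:M.
Proof.
apply/matrixP => a b; rewrite mul_mx_altsign !mxE.
by case: eqVneq => [->|_]; rewrite ?mul0r // mulr1n -expr2 sqrr_sign.
Qed.

Lemma lower_bidiag_mxP k (alpha beta : nat -> F) :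
  lower_bidiagonal (lower_bidiag_mx k alpha beta).
Proof. by move=> a b /negbTE ab /negbTE ab1; rewrite mxE ab ab1. Qed.

Lemma upper_bidiag_mxP k (alpha beta : nat -> F) :
  upper_bidiagonal (upper_bidiag_mx k alpha beta).
Proof. by move=> a b /negbTE ab /negbTE ab1; rewrite mxE ab ab1. Qed.

(** Column [a] is supported in rows [a] and [a.+1], so columns at distance two or more have disjoint
    supports. *)
Lemma lower_bidiagonal_gram_eq0 m n (B : 'M[F]_(m, n)) (a b : 'I_n) :
  lower_bidiagonal B -> (a.+1 < b \/ b.+1 < a)%N -> (B^T *m B) a b = 0.
Proof.
move=> hB ab; rewrite mxE big1 // => r _; rewrite mxE.
have [ra|ra] := boolP ((r == a :> nat) || (r == a.+1 :> nat)).
  by rewrite (hB r b) ?mulr0 //; lia.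
by rewrite (hB r a) ?mul0r //; lia.
Qed.

Lemma upper_bidiagonal_gram_eq0 m n (B : 'M[F]_(m, n)) (a b : 'I_n) :
  upper_bidiagonal B -> (a.+1 < b \/ b.+1 < a)%N -> (B^T *m B) a b = 0.
Proof.
move=> hB ab; rewrite mxE big1 // => r _; rewrite mxE.
have [ra|ra] := boolP ((a == r :> nat) || (a == r.+1 :> nat)).
  by rewrite (hB r b) ?mulr0 //; lia.
by rewrite (hB r a) ?mul0r //; lia.
Qed.

(** The two columns meet only in row [a]. The uniqueness argument needs these subdiagonal entries to
    be positive. *)
Lemma lower_bidiag_gram_sub k (alpha beta : nat -> F) (a b : 'I_k) :
  b.+1 = a ->
  ((lower_bidiag_mx k alpha beta)^T *m lower_bidiag_mx k alpha beta) a b =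
  alpha a.+1 * beta a.+1.
Proof.
move=> ba; have a_ltk1 : (a < k.+1)%N by rewrite ltnW ?ltnS.
rewrite mxE (bigD1 (Ordinal a_ltk1)) //= big1 ?addr0 => [|r].
  by rewrite !mxE /= eqxx -ba eqxx; case: eqP => //; lia.
rewrite -val_eqE /= => ra; rewrite !mxE (negbTE ra) /=.
have [rb|_] := eqVneq (r : nat) b; last by rewrite -ba in ra; rewrite (negbTE ra) mulr0.
by case: eqP; [lia|rewrite mul0r].
Qed.

(** Here the two columns meet in row [b], one row higher than in the lower bidiagonal case, whence
    the index [a] in place of [a.+1]. *)
Lemma upper_bidiag_gram_sub k (alpha beta : nat -> F) (a b : 'I_k) :
  b.+1 = a ->
  ((upper_bidiag_mx k alpha beta)^T *m upper_bidiag_mx k alpha beta) a b =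
  alpha a * beta a.
Proof.
move=> ba; rewrite mxE (bigD1 b) //= big1 ?addr0 => [|r].
  rewrite !mxE -ba eqxx; case: eqP => [|_]; first by lia.
  by rewrite eqxx mulrC.
rewrite -val_eqE /= => rb; rewrite !mxE (eq_sym (b : nat)) (negbTE rb) -ba /=.
case: (eqVneq (b.+1 : nat) r) => [br|_].
  by rewrite -br; case: eqP; [lia|rewrite mulr0].
by rewrite eqSS (eq_sym (b : nat)) (negbTE rb) mul0r.
Qed.

(* Comparing the i-th columns of the two recurrences, [c w_j + (-1)^i a v_j],
   with [j = i + 1] and [a, c] the subdiagonal entries, is a combination of
   [v_1, ..., v_i] orthogonal to all of them, hence vanishes; the norms
   give [a = c]. *)
Lemma hessenberg_altsign n k (S : 'M[F]_n) (V W : 'M[F]_(n, k)) (T Th : 'M[F]_k) :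
  V^T *m V = 1%:M -> W^T *m W = 1%:M ->
  (forall i j : 'I_k, i.+1 = j -> 0 < T j i) ->
  (forall i j : 'I_k, i.+1 = j -> 0 < Th j i) ->
  (forall i j : 'I_k, (i.+1 < j)%N -> T j i = 0) ->
  (forall i j : 'I_k, (i.+1 < j)%N -> Th j i = 0) ->
  (forall i : 'I_k, (i.+1 < k)%N -> col i (S *m V) = col i (V *m T)) ->
  (forall i : 'I_k, (i.+1 < k)%N ->
    col i ((1%:M - S) *m W) = col i (W *m Th)) ->
  (forall i : 'I_k, i.+1 = 1%N -> col i W = col i V) ->
  W = V *m altsign_mx F k.
Proof.
move=> VV WW T_gt0 Th_gt0 T0 Th0 eV eW start.
suff colW q (j : 'I_k) : j = q :> nat -> col j W = (-1) ^+ j *: col j V.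
  apply/matrixP => r j; rewrite mul_mx_altsign.
  by have /matrixP/(_ r 0) := colW _ j erefl; rewrite !mxE mulrC.
elim/ltn_ind: q j => -[|i] IH j jq; first by rewrite start ?jq // scale1r.
have ik : (i.+1 < k)%N by rewrite -jq ltn_ord.
(* [o] is the column before [j], whose recurrences produce column [j]; [s] is its sign. *)
pose o := Ordinal (ltnW ik); pose s : F := (-1) ^+ i.
have {}IH (q : 'I_k) : (q <= i)%N -> col q W = (-1) ^+ q *: col q V.
  by move=> qi; apply: IH erefl; rewrite ltnS.
(* Stripped of its subdiagonal entry, a column of a Hessenberg matrix has no entry below row [o]. *)
have tail (X : 'M[F]_k) : (forall i j : 'I_k, (i.+1 < j)%N -> X j i = 0) ->
    forall q : 'I_k, (i < q)%N -> (col o X - X j o *: delta_mx j 0) q 0 = 0 :> F.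
  move=> X0 q iq; rewrite !mxE eqxx andbT.
  have [->|qj] := eqVneq q j; first by rewrite mulr1 subrr.
  by rewrite mulr0 subr0 X0 //=; move: qj; rewrite -val_eqE /=; lia.
move: (tail _ T0) (tail _ Th0) => {tail}.
set t := col o T - _; set th := col o Th - _ => t0 th0.
have colT : col o T = t + T j o *: delta_mx j 0 by rewrite subrK.
have colTh : col o Th = th + Th j o *: delta_mx j 0 by rewrite subrK.
clearbody t th.
have col_mulmx (X : 'M[F]_n) (Y : 'M[F]_(n, k)) : col o (X *m Y) = X *m col o Y.
  by rewrite !colE mulmxA.
(* Coordinates in [V] of the combination of w_j and v_j in [gE], found by putting w_o = s v_o and
   [Wth] into the recurrence for [1%:M - S]. *)
pose g := s *: delta_mx o 0 - s *: t - altsign_mx F k *m th.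
have Wth : W *m th = V *m (altsign_mx F k *m th).
  apply/matrixP => r c; rewrite mulmxA ord1 !mxE; apply: eq_bigr => q _.
  have [qi|iq] := leqP q i; last by rewrite th0 // !mulr0.
  rewrite mul_mx_altsign; congr (_ * _).
  by have /matrixP/(_ r 0) := IH q qi; rewrite !mxE mulrC.
have gE : Th j o *: col j W + (s * T j o) *: col j V = V *m g.
  have e1 : S *m col o V = V *m t + T j o *: col j V.
    by rewrite -col_mulmx eV // colE -mulmxA -colE colT mulmxDr -scalemxAr -colE.
  have e2 : (1%:M - S) *m col o W = W *m th + Th j o *: col j W.
    by rewrite -col_mulmx eW // colE -mulmxA -colE colTh mulmxDr -scalemxAr -colE.
  move: e2; rewrite IH //= -/s mulmxBl mul1mx -scalemxAr e1 Wth => e2.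
  rewrite /g !mulmxBr -!scalemxAr -colE; move: e2.
  move: (V *m t) (V *m (altsign_mx F k *m th)) => x y e2.
  rewrite -[Th j o *: _](addKr y) -e2.
  by apply/matrixP => r c; rewrite !mxE; ring.
have VW (X : 'M[F]_(n, k)) q : (V^T *m col j X) q 0 = (V^T *m X) q j.
  by rewrite colE mulmxA -colE mxE.
(* In rows up to [i], pair with v_q, equal to w_q up to sign, hence orthogonal to both v_j and w_j.
   In later rows all three terms of [g] vanish. *)
have g0 : g = 0.
  apply/matrixP => q c; rewrite ord1 [RHS]mxE; have [qi|iq] := leqP q i.
    have qj : q != j by rewrite -val_eqE /= jq; lia.
    have -> : g q 0 = (V^T *m (V *m g)) q 0 by rewrite mulmxA VV mul1mx.
    rewrite -gE mulmxDr -!scalemxAr mxE [X in X + _]mxE [X in _ + X]mxE !VW VV.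
    have -> : (V^T *m W) q j = (-1) ^+ q * (W^T *m W) q j.
      rewrite !mxE mulr_sumr; apply: eq_bigr => r _; rewrite !mxE mulrA.
      have /matrixP/(_ r 0) := IH q qi; rewrite !mxE => ->.
      by rewrite mulrA -expr2 sqrr_sign mul1r.
    by rewrite WW !mxE (negbTE qj) !mulr0 addr0.
  rewrite /g /altsign_mx mul_diag_mx !mxE t0 // th0 // -val_eqE /=.
  by rewrite gtn_eqF // !mulr0 !subr0.
have sqnorm (X : 'M[F]_(n, k)) c : X^T *m X = 1%:M ->
    ((c *: col j X)^T *m (c *: col j X)) 0 0 = c ^+ 2.
  move=> XX; rewrite -[RHS]mulr1; have := congr1 (fun M : 'M_k => M j j) XX.
  rewrite !mxE eqxx mulr1n => <-; rewrite mulr_sumr; apply: eq_bigr => r _.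
  by rewrite !mxE; ring.
have eW' : Th j o *: col j W = (- s * T j o) *: col j V.
  by apply/eqP; rewrite mulNr scaleNr -addr_eq0 gE g0 mulmx0.
(* Both are positive, and [eW'] equates their squares since the two columns have norm 1. *)
have TE : Th j o = T j o.
  apply/eqP; rewrite -(@eqrXn2 _ 2) ?ltW ?Th_gt0 ?T_gt0 //.
  by rewrite -(sqnorm W) // eW' sqnorm // exprMn sqrrN sqrr_sign mul1r.
apply: (scalerI (lt0r_neq0 (Th_gt0 o j _))) => //.
by rewrite eW' scalerA jq exprS TE mulN1r mulrC.
Qed.

End Lanczos.

(** * Comparison of the two Lanczos processes *)

Section JointLanczos.
Variables (F : rcfType) (m p n k : nat) (QA : 'M[F]_(m, n)) (QL : 'M[F]_(p, n)).
Variables (U : 'M[F]_(m, k.+1)) (V : 'M[F]_(n, k)) (vnext : 'cV[F]_n).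
Variables (Uh : 'M[F]_(p, k)) (Vh : 'M[F]_(n, k)) (vhnext : 'cV[F]_n).
Variables alpha beta alphah betah : nat -> F.
Hypothesis QAQL : orthonormal_cols (col_mx QA QL).
Hypothesis hJL : joint_lanczos QA QL U V vnext Uh Vh vhnext alpha beta alphah betah.

Lemma orthonormal_row_mxl n1 n2 (M : 'M[F]_(n, n1)) (N : 'M[F]_(n, n2)) :
  orthonormal_cols (row_mx M N) -> M^T *m M = 1%:M.
Proof.
rewrite /orthonormal_cols tr_row_mx mul_col_row scalar_mx_block.
by case/eq_block_mx.
Qed.

Lemma QL_gramE : QL^T *m QL = 1%:M - QA^T *m QA.
Proof.
by have := QAQL; rewrite /orthonormal_cols tr_col_mx mul_row_col => <-; rewrite addrC addKr.
Qed.

(** Composing the two relations of each process reduces QA^T QA and QL^T QL to tridiagonal form, up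
    to a residual in the last column; [hessenberg_altsign] asks for the other columns only. *)
Lemma joint_lanczos_altsign : Vh = V *m altsign_mx F k.
Proof.
have [_ hV _ hVh a_gt0 b_gt0 ah_gt0 bh_gt0 _ start eA eAT eL eLT] := hJL.
(* The residual is an outer product with the last row of [M], so it reaches only columns where that
   row is nonzero. *)
have col_next r (x : 'cV[F]_n) c (M : 'M[F]_(r, k)) (i : 'I_k) :
    (forall a : 'I_r, a.+1 = r -> M a i = 0) ->
  col i (c *: (x *m (e_ F r r)^T) *m M) = 0.
  move=> M0; apply/matrixP => a b; rewrite -scalemxAl -mulmxA !mxE big1 ?mulr0 //.
  move=> d _; rewrite !mxE big1 ?mulr0 // => q _; rewrite !mxE.
  by case: eqP => [/M0->|]; rewrite ?mulr0 ?mul0r.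
apply: (hessenberg_altsign (S := QA^T *m QA)
  (T := (lower_bidiag_mx k alpha beta)^T *m lower_bidiag_mx k alpha beta)
  (Th := (upper_bidiag_mx k alphah betah)^T *m upper_bidiag_mx k alphah betah)).
- exact: orthonormal_row_mxl hV.
- exact: orthonormal_row_mxl hVh.
- move=> i j ij; rewrite lower_bidiag_gram_sub //.
  by apply: mulr_gt0; [apply: a_gt0|apply: b_gt0]; have := ltn_ord j; lia.
- move=> i j ij; rewrite upper_bidiag_gram_sub //.
  by apply: mulr_gt0; [apply: ah_gt0|apply: bh_gt0]; have := ltn_ord j; lia.
- by move=> i j ij; apply: lower_bidiagonal_gram_eq0 (@lower_bidiag_mxP _ _ _ _) _; right.
- by move=> i j ij; apply: upper_bidiagonal_gram_eq0 (@upper_bidiag_mxP _ _ _ _) _; right.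
- move=> i ik; rewrite -mulmxA eA mulmxA eAT mulmxDl raddfD /= col_next ?addr0 ?mulmxA // => a ak.
  by apply: lower_bidiag_mxP; lia.
- move=> i ik; rewrite -QL_gramE -mulmxA eL mulmxA eLT mulmxDl raddfD /= col_next ?addr0 ?mulmxA // => a ak.
  by apply: upper_bidiag_mxP; lia.
- exact: start.
Qed.

Lemma joint_lanczos_QL :
  QL *m V = Uh *m (upper_bidiag_mx k alphah betah *m altsign_mx F k).
Proof.
rewrite mulmxA -(jl_QL hJL) joint_lanczos_altsign -!mulmxA.
by rewrite altsign_mxK mulmx1.
Qed.

(** The two Gram matrices are the compressions to [V] of QA^T QA and QL^T QL, which sum to the
    identity. *)
Lemma joint_lanczos_gram :
  let B := lower_bidiag_mx k alpha beta in
  let Bb := upper_bidiag_mx k alphah betah *m altsign_mx F k in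
  B^T *m B + Bb^T *m Bb = 1%:M.
Proof.
move=> B Bb.
have gram r q (X : 'M[F]_(r, q)) (M : 'M[F]_(q, k)) (Q : 'M[F]_(r, n)) :
    X^T *m X = 1%:M -> Q *m V = X *m M -> M^T *m M = V^T *m (Q^T *m Q) *m V.
  by move=> XX QV; rewrite !mulmxA -trmx_mul -mulmxA QV trmx_mul mulmxA -(mulmxA M^T) XX mulmx1.
rewrite (gram _ _ _ _ _ (jl_U hJL) (jl_QA hJL)).
rewrite (gram _ _ _ _ _ (jl_Uh hJL) joint_lanczos_QL).
rewrite -mulmxDl -mulmxDr QL_gramE addrC subrK mulmx1.
exact: orthonormal_row_mxl (jl_V hJL).
Qed.

(** The first factor is triangular with diagonal [alphah i] > 0, the second is its own inverse.
    Invertibility provides the nonzero pivots for [trig_gram_upper_bidiagonal]. *)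
Lemma upper_bidiag_altsign_unit :
  upper_bidiag_mx k alphah betah *m altsign_mx F k \in unitmx.
Proof.
rewrite unitmx_mul; apply/andP; split; last first.
  by case: (mulmx1_unit (altsign_mxK F k)).
rewrite -unitmx_tr unitmxE det_trig.
  rewrite unitfE; apply/prodf_neq0 => i _; rewrite !mxE eqxx.
  by rewrite lt0r_neq0 // (jl_alphah hJL) /=.
by apply/trig_trmxP => a b ba; apply: upper_bidiag_mxP; lia.
Qed.

End JointLanczos.

(** * Bidiagonality from the Gram matrix, and truncation of products *)

Section Truncation.
Variable F : rcfType.

(** In the sum of M r a * M r b, terms with r > a vanish by triangularity and those with r < a by
    induction on rows; what remains is M a b times a nonzero pivot. *)
Lemma trig_gram_upper_bidiagonal n (M : 'M[F]_n) :
  M \in unitmx -> is_trig_mx M^T ->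
  (forall a b : 'I_n, (a.+1 < b)%N -> (M^T *m M) a b = 0) ->
  upper_bidiagonal M.
Proof.
move=> Mu /[dup] trM /trig_trmxP M0 gram0.
have diag a : M a a != 0.
  move: Mu; rewrite -unitmx_tr unitmxE det_trig // unitfE => /prodf_neq0/(_ a isT).
  by rewrite mxE.
suff up q (a b : 'I_n) : a = q :> nat -> (a.+1 < b)%N -> M a b = 0.
  by move=> a b ba ba1; have [ab|ab] := ltnP b a; [apply: M0|apply: (up a) => //; lia].
elim/ltn_ind: q a b => q IH a b aq ab; apply: (mulfI (diag a)); rewrite mulr0.
rewrite -(gram0 a b ab) mxE (bigD1 a) //= mxE big1 ?addr0 // => r ra.
rewrite mxE; have [ar|ar] := ltnP a r; first by rewrite M0 ?mul0r.
rewrite (IH r _ r b) ?mulr0 //; move: ra; rewrite -val_eqE /=; lia.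
Qed.

(** Every dropped term carries a zero of [M]. A general [f] serves both leading columns and
    transposed leading blocks. *)
Lemma mxsub_mul_widen m q r n m' n' (f : 'I_m' -> 'I_m) (g : 'I_n' -> 'I_n)
    (h : (r <= q)%N) (X : 'M[F]_(m, q)) (M : 'M[F]_(q, n)) :
  (forall (a : 'I_q) b, (r <= a)%N -> M a (g b) = 0) ->
  mxsub f (widen_ord h) X *m mxsub (widen_ord h) g M = mxsub f g (X *m M).
Proof.
move=> M0; apply/matrixP => a b; rewrite !mxE (bigID (fun c : 'I_q => (c < r)%N)) /=.
rewrite [X in _ + X]big1 ?addr0 => [|c].
  by rewrite (big_ord_narrow h); apply: eq_bigr => c _; rewrite !mxE.
by rewrite -leqNgt => rc; rewrite M0 ?mulr0.
Qed.

Lemma lead_submx_gram m n r s (hr : (r <= m)%N) (hs : (s <= n)%N) (M : 'M[F]_(m, n)) :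
  (forall (a : 'I_m) (b : 'I_n), (r <= a)%N -> (b < s)%N -> M a b = 0) ->
  (lead_submx hr hs M)^T *m lead_submx hr hs M =
  mxsub (widen_ord hs) (widen_ord hs) (M^T *m M).
Proof.
by move=> M0; rewrite /lead_submx trmx_mxsub mxsub_mul_widen // => a b ra; apply: M0 => /=.
Qed.

Lemma mxsub_widen1 n s (h : (s <= n)%N) :
  mxsub (widen_ord h) (widen_ord h) 1%:M = 1%:M :> 'M[F]_s.
Proof. by apply/matrixP => a b; rewrite !mxE. Qed.

Lemma orthonormal_lead_cols n k l (h : (l <= k)%N) (M : 'M[F]_(n, k)) :
  orthonormal_cols M -> orthonormal_cols (lead_cols h M).
Proof.
rewrite /orthonormal_cols /lead_cols => MM.
by rewrite trmx_mxsub -mxsub_mul MM mxsub_widen1.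
Qed.

Lemma orthonormal_mulmx n k q (M : 'M[F]_(n, k)) (N : 'M[F]_(k, q)) :
  orthonormal_cols M -> orthonormal_cols N -> orthonormal_cols (M *m N).
Proof.
by rewrite /orthonormal_cols trmx_mul mulmxA -(mulmxA N^T) => -> ; rewrite mulmx1.
Qed.

Lemma lower_bidiagonal_lead m n r s (hr : (r <= m)%N) (hs : (s <= n)%N) (M : 'M[F]_(m, n)) :
  lower_bidiagonal M -> lower_bidiagonal (lead_submx hr hs M).
Proof. by move=> hM a b ab ab1; rewrite mxE hM. Qed.

Lemma upper_bidiagonal_lead m n r s (hr : (r <= m)%N) (hs : (s <= n)%N) (M : 'M[F]_(m, n)) :
  upper_bidiagonal M -> upper_bidiagonal (lead_submx hr hs M).
Proof. by move=> hM a b ab ab1; rewrite mxE hM. Qed.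

End Truncation.

(** * The restarted relations *)

Theorem theorem4p7 (F : rcfType) (m p n k l : nat)
  (A : 'M[F]_(m, n)) (L : 'M[F]_(p, n))
  (QA : 'M[F]_(m, n)) (QL : 'M[F]_(p, n)) (R : 'M[F]_n)
  (U : 'M[F]_(m, k.+1)) (V : 'M[F]_(n, k)) (vnext : 'cV[F]_n)
  (Uh : 'M[F]_(p, k)) (Vh : 'M[F]_(n, k)) (vhnext : 'cV[F]_n)
  (alpha beta alphah betah : nat -> F)
  (lambda mu : nat -> F)
  (G : 'M[F]_k.+1) (P Gb : 'M[F]_k)
  (hmpn : (n <= m + p)%N)
  (hrank : \rank (col_mx A L) = n)
  (hQR : economy_QR A L QA QL R)
  (hJL : joint_lanczos QA QL U V vnext Uh Vh vhnext alpha beta alphah betah)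
  (hl : (1 <= l)%N) (hlk : (l < k)%N)
  (hlambda : forall i, (1 <= i <= k - l)%N -> 0 <= lambda i)
  (hmu : forall i, (1 <= i <= k - l)%N -> 0 <= mu i)
  (hshift : forall i, (1 <= i <= k - l)%N -> lambda i ^+ 2 + mu i ^+ 2 = 1)
  (hsteps : implicit_QR_steps (k - l) lambda
              (lower_bidiag_mx k alpha beta)
              (upper_bidiag_mx k alphah betah *m altsign_mx F k)
              G P Gb) :
  let B := lower_bidiag_mx k alpha beta in
  let Bb := upper_bidiag_mx k alphah betah *m altsign_mx F k in
  let Vp := lead_cols (ltnW hlk) (V *m P) in
  let Up := lead_cols (leqW hlk) (U *m G) in
  let Uhp := lead_cols (ltnW hlk) (Uh *m Gb) in
  let Bp := lead_submx (leqW hlk) (ltnW hlk) (G^T *m B *m P) in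
  let Bbp := lead_submx (ltnW hlk) (ltnW hlk) (Gb^T *m Bb *m P) in
  let Hp := invmx R *m Vp in
  [/\ JBD_factors Vp Up Uhp Bp Bbp,
      A *m Hp = Up *m Bp,
      L *m Hp = Uhp *m Bbp
    & Bp^T *m Bp + Bbp^T *m Bbp = 1%:M].
Proof.
move=> B Bb Vp Up Uhp Bp Bbp Hp.
have [eAL QAQL _] := hQR.
have [hU hV hUh _ _ _ _ _ _ _ eA _ _ _] := hJL.
have eL := joint_lanczos_QL QAQL hJL.
have gramBB := joint_lanczos_gram QAQL hJL.
have Bbu := upper_bidiag_altsign_unit hJL.
rewrite -/B -/Bb in eA eL gramBB Bbu hsteps.
have trBb : is_trig_mx Bb^T.
  apply/trig_trmxP => a b ba; rewrite mul_mx_altsign upper_bidiag_mxP ?mul0r //; lia.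
have [|GG PP GbGb lowB upBb] := implicit_QR_steps_shape _ (@lower_bidiag_mxP F k alpha beta) trBb hsteps.
  by lia.
rewrite -/B in lowB; clearbody B Bb.
(* For square factors, orthonormal columns give orthonormal rows, so G G^T can be cancelled inside
   products. *)
have [/mulmx1C GG' /mulmx1C GbGb'] := (GG, GbGb).
set B1 := G^T *m B *m P in Bp lowB *; set Bb1 := Gb^T *m Bb *m P in Bbp upBb *.
have gram1 : B1^T *m B1 + Bb1^T *m Bb1 = 1%:M.
  rewrite !trmx_mul !trmxK !mulmxA -(mulmxA _ G) GG' mulmx1 -(mulmxA _ Gb) GbGb' mulmx1.
  by rewrite -mulmxDl -!(mulmxA P^T) -mulmxDr gramBB mulmx1.
have Bb1u : Bb1 \in unitmx.
  rewrite !unitmx_mul Bbu unitmx_tr.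
  by case/mulmx1_unit: GbGb => _ ->; case/mulmx1_unit: PP => _ ->.
(* Off the diagonal Bb1^T Bb1 is minus B1^T B1, which is tridiagonal. *)
have bidBb : upper_bidiagonal Bb1.
  apply: trig_gram_upper_bidiagonal => // a b ab.
  rewrite -[_ *m _](addKr (B1^T *m B1)) gram1 mxE [X in X + _]mxE.
  rewrite lower_bidiagonal_gram_eq0; [|by []|by left].
  by rewrite oppr0 add0r mxE -val_eqE /= ltn_eqF // ltnW.
(* The rank n of the stacked matrix, a left multiple of [R], bounds the rank of [R] from below. *)
have Ru : R \in unitmx.
  rewrite -row_full_unit /row_full eqn_leq rank_leq_col /= -{1}hrank eAL.
  exact: mxrankM_maxr.
have [eAR eLR] : A = QA *m R /\ L = QL *m R.
  by apply: eq_col_mx; rewrite eAL mul_col_mx.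
(* The first l columns of a lower bidiagonal matrix reach row l+1, so l+1 rows are kept here against
   l for the upper factor. *)
have B1_0 (a : 'I_k.+1) (b : 'I_k) : (l.+1 <= a)%N -> (b < l)%N -> B1 a b = 0.
  by move=> la bl; apply: lowB; lia.
have Bb1_0 (a b : 'I_k) : (l <= a)%N -> (b < l)%N -> Bb1 a b = 0.
  by move=> la bl; apply: bidBb; lia.
split.
- split.
  + apply/orthonormal_lead_cols/orthonormal_mulmx => //.
    exact: orthonormal_row_mxl hV.
  + exact/orthonormal_lead_cols/orthonormal_mulmx.
  + exact/orthonormal_lead_cols/orthonormal_mulmx.
  + exact: lower_bidiagonal_lead.
  + exact: upper_bidiagonal_lead.
(* [R] cancels against its inverse in [Hp], leaving the first l columns of QA V P = (U G) B1. *)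
- rewrite eAR -mulmxA mulKVmx // /Up /Bp /lead_cols mxsub_mul_widen; last first.
    by move=> a b la; apply: B1_0 => /=.
  by rewrite /B1 !mulmxA -(mulmxA U) GG' mulmx1 -eA /Vp /lead_cols mulmx_colsub mulmxA.
- rewrite eLR -mulmxA mulKVmx // /Uhp /Bbp /lead_cols mxsub_mul_widen; last first.
    by move=> a b la; apply: Bb1_0 => /=.
  by rewrite /Bb1 !mulmxA -(mulmxA Uh) GbGb' mulmx1 -eL /Vp /lead_cols mulmx_colsub mulmxA.
- rewrite !lead_submx_gram //.
  by rewrite -(mxsub_widen1 F (ltnW hlk)) -gram1; apply/matrixP => a b; rewrite !mxE.
Qed.
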